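(* Let $\mathcal{H}$ be a complex Hilbert space, let $T_1,T_2\in\mathcal{B}(\mathcal{H})$ be contractions and let $Q\in\mathcal{B}(\mathcal{H})$ be a unitary such that $T_2T_1=QT_1T_2$. Then there exist a Hilbert space $\mathcal{K}\supseteq\mathcal{H}$, isometries $V_1,V_2\in\mathcal{B}(\mathcal{K})$ and a unitary $\overline{Q}\in\mathcal{B}(\mathcal{K})$, with $\mathcal{H}$ reducing $\overline{Q}$ and $\overline{Q}|_{\mathcal{H}}=Q$, such that (i) $V_2V_1=\overline{Q}V_1V_2$; and (ii) $V_i$ is a lifting of $T_i$ for $i=1,2$, so that $T_1^nT_2^m=P_{\mathcal{H}}V_1^nV_2^m|_{\mathcal{H}}$ and $T_2^nT_1^m=P_{\mathcal{H}}V_2^nV_1^m|_{\mathcal{H}}$ for all integers $n,m\geq 0$. In fact, given any $q\in\mathbb{T}$, one can choose $\overline{Q}=Q\oplus qI_{\mathcal{K}\ominus\mathcal{H}}$.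
   Context: For Hilbert spaces $\mathcal{H}\subseteq\mathcal{K}$, an operator $S\in\mathcal{B}(\mathcal{K})$ is a lifting of $T\in\mathcal{B}(\mathcal{H})$ if $S(\mathcal{H}^\perp)\subseteq\mathcal{H}^\perp$ and $T=P_{\mathcal{H}}S|_{\mathcal{H}}$ (equivalently $S^*|_{\mathcal{H}}=T^*$). $P_{\mathcal{H}}$ is the orthogonal projection onto $\mathcal{H}$; $\mathbb{T}$ is the unit circle. *)

(* Defs.v *)
From HB Require Import structures.
From mathcomp Require Import all_boot all_order all_algebra.
From mathcomp Require Import reals.
From mathcomp Require Import complex.
Set Implicit Arguments. Unset Strict Implicit. Unset Printing Implicit Defensive.
Import Order.TTheory GRing.Theory Num.Theory.
Local Open Scope ring_scope.

Definition ip_norm (R : realType) (V : Type) (ip : V -> V -> R[i]) (x : V) : R :=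
  Num.sqrt (complex.Re (ip x x)).

Definition ip_cauchy (R : realType) (V : lmodType R[i]) (ip : V -> V -> R[i])
  (u : nat -> V) : Prop :=
  forall e : R, 0 < e -> exists N : nat, forall m n : nat, (N <= m)%N -> (N <= n)%N ->
    ip_norm ip (u m - u n) < e.

Definition ip_cvg (R : realType) (V : lmodType R[i]) (ip : V -> V -> R[i])
  (u : nat -> V) (l : V) : Prop :=
  forall e : R, 0 < e -> exists N : nat, forall n : nat, (N <= n)%N ->
    ip_norm ip (u n - l) < e.

Record hilbert (R : realType) := Hilbert {
  hcarrier :> lmodType R[i];
  hip : hcarrier -> hcarrier -> R[i];
  hip_linear : forall (a : R[i]) (x y z : hcarrier),
      hip (a *: x + y) z = a * hip x z + hip y z;
  hip_sym : forall x y : hcarrier, hip y x = conjc (hip x y);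
  hip_ge0 : forall x : hcarrier, 0 <= hip x x;
  hip_eq0 : forall x : hcarrier, hip x x = 0 -> x = 0;
  hcomplete : forall u : nat -> hcarrier, ip_cauchy hip u -> exists l, ip_cvg hip u l
}.

Section Ops.
Variable R : realType.

Definition hnorm (H : hilbert R) (x : H) : R := ip_norm (@hip R H) x.

Definition hbounded_op (H K : hilbert R) (f : H -> K) : Prop :=
  (forall (a : R[i]) (x y : H), f (a *: x + y) = a *: f x + f y) /\
  exists M : R, forall x : H, hnorm (f x) <= M * hnorm x.

Definition hcontraction (H : hilbert R) (T : H -> H) : Prop :=
  hbounded_op T /\ forall x : H, hnorm (T x) <= hnorm x.

Definition hisometry (H : hilbert R) (V : H -> H) : Prop :=
  hbounded_op V /\ forall x : H, hnorm (V x) = hnorm x.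

Definition hunitary (H : hilbert R) (U : H -> H) : Prop :=
  hisometry U /\ forall y : H, exists x : H, U x = y.

(* H is (identified with) a closed subspace of K through an
   inner-product-preserving linear embedding J. *)
Definition hembedding (H K : hilbert R) (J : H -> K) : Prop :=
  hbounded_op J /\ forall x y : H, hip (J x) (J y) = hip x y.

Definition horth (H K : hilbert R) (J : H -> K) (z : K) : Prop :=
  forall x : H, hip z (J x) = 0.

(* The compression P_H S|_H equals T (as operators on H), i.e. T = J^* S J. *)
Definition hcompresses_to (H K : hilbert R) (J : H -> K) (S : K -> K) (T : H -> H) : Prop :=
  forall x y : H, hip (T x) y = hip (S (J x)) (J y).

Definition hlifting (H K : hilbert R) (J : H -> K) (S : K -> K) (T : H -> H) : Prop :=
  (forall z : K, horth J z -> horth J (S z)) /\ hcompresses_to J S T.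

Definition hreduces (H K : hilbert R) (J : H -> K) (S : K -> K) : Prop :=
  (forall x : H, exists y : H, S (J x) = J y) /\
  (forall z : K, horth J z -> horth J (S z)).

End Ops.

(* Main.v *)
Require Import Defs.
From HB Require Import structures.
From mathcomp Require Import all_boot all_order all_algebra.
From mathcomp Require Import boolp classical_sets functions reals topology normedtype sequences.
From mathcomp Require Import complex ring lra.
Import Order.TTheory GRing.Theory Num.Theory.
Import numFieldNormedType.Exports.
Local Open Scope ring_scope.
Set Implicit Arguments. Unset Strict Implicit. Unset Printing Implicit Defensive.

(* Ando's construction, twisted by [q].  Let [D_i] be the defect operator of
   [T_i], so that [|D_i h|^2 = |h|^2 - |T_i h|^2].  On [H] plus a sequence of
   blocks [e_0, e_1, ...] in [H x H], the maps
   [W_i (h, e_0, e_1, ...) = (T_i h, (D_i h, 0), e_0, e_1, ...)] are isometries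
   lifting [T_i], but they need not [Q]-commute.  Both [W_1 W_2] and [W_2 W_1]
   shift by two blocks, and since [Q] is isometric the vectors
   [(D_1 T_2 h, D_2 h)] and [q^-1 (D_2 T_1 h, D_1 h)] have the same norm, so a
   unitary [v] on pairs of blocks carries the first to the second.  Let [V] be
   the identity on [H] and [q^-n v] on the [n]-th pair of blocks; then
   [V_1 = V W_1] and [V_2 = W_2 V^-1] satisfy [V_2 V_1 = (Q + q I) V_1 V_2],
   because conjugating the two-block shift by [V] multiplies it by [q^-1]. *)

(** * Real inner product, Cauchy-Schwarz and limits *)

Section RealInnerProduct.
Variable R : realType.
Implicit Types H K L : hilbert R.

(** Estimates are made on the real part, which is symmetric and bilinear over the reals; [hipE]
    recovers the complex product from it. *)
Definition rip H (x y : H) : R := complex.Re (hip x y).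
Definition nsq H (x : H) : R := rip x x.

Lemma ripDl H (x y z : H) : rip (x + y) z = rip x z + rip y z.
Proof.
rewrite /rip -[x in LHS]scale1r hip_linear mul1r.
by case: (hip x z) => ? ?; case: (hip y z).
Qed.

Lemma ripC H (x y : H) : rip x y = rip y x.
Proof. by rewrite /rip [hip x y]hip_sym; case: (hip y x). Qed.

Lemma ripZil H (a : R[i]) (x z : H) :
  rip (a *: x) z = complex.Re a * rip x z - complex.Im a * complex.Im (hip x z).
Proof.
have h0 : hip (0 : H) z = 0.
  have := hip_linear 1 0 0 z; rewrite scale1r addr0 mul1r => e.
  by apply: (@addrI _ (hip (0 : H) z)); rewrite addr0 -e.
rewrite /rip -[_ *: x]addr0 hip_linear h0 addr0.
by case: a => a b; case: (hip x z).
Qed.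

Lemma ripZl H (t : R) (x z : H) : rip (t%:C%C *: x) z = t * rip x z.
Proof. by rewrite ripZil /= mul0r subr0. Qed.

Lemma ripDr H (x y z : H) : rip z (x + y) = rip z x + rip z y.
Proof. by rewrite !(ripC z) ripDl. Qed.

Lemma ripZr H (t : R) (x z : H) : rip z (t%:C%C *: x) = t * rip z x.
Proof. by rewrite !(ripC z) ripZl. Qed.

Lemma ripNl H (x z : H) : rip (- x) z = - rip x z.
Proof.
have -> : - x = (-1)%:C%C *: x by rewrite rmorphN1 scaleN1r.
by rewrite ripZl mulN1r.
Qed.

Lemma ripNr H (x z : H) : rip z (- x) = - rip z x.
Proof. by rewrite !(ripC z) ripNl. Qed.

Lemma rip0l H (z : H) : rip 0 z = 0.
Proof. by rewrite -(scale0r 0) (_ : 0 = 0%:C%C) // ripZl mul0r. Qed.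

Lemma rip0r H (z : H) : rip z 0 = 0.
Proof. by rewrite ripC rip0l. Qed.

Definition ripE := (ripDl, ripDr, ripNl, ripNr, ripZl, ripZr, rip0l, rip0r).

Lemma rip_iE H (x y : H) : complex.Im (hip x y) = rip x ('i%C *: y).
Proof. by rewrite ripC ripZil /= mul0r mul1r add0r hip_sym; case: (hip y x). Qed.

Lemma ripii H (x y : H) : rip ('i%C *: x) ('i%C *: y) = rip x y.
Proof.
rewrite ripZil /= mul0r sub0r mul1r rip_iE scalerA.
have -> : 'i%C * 'i%C = - 1 :> R[i].
  apply/eqP; rewrite eq_complex /=.
  by rewrite !mul0r !mulr0 mulr1 addr0 oppr0 add0r !eqxx.
by rewrite scaleN1r ripNr opprK.
Qed.

Lemma hipE H (x y : H) : hip x y = (rip x y +i* rip x ('i%C *: y))%C.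
Proof. by rewrite -rip_iE /rip; case: (hip x y). Qed.

Lemma nsq_ge0 H (x : H) : 0 <= nsq x.
Proof. by have := hip_ge0 x; rewrite /nsq /rip; case: (hip x x) => a b /andP[]. Qed.

Lemma nsq_eq0 H (x : H) : nsq x = 0 -> x = 0.
Proof.
rewrite /nsq /rip => e; apply: hip_eq0.
have := hip_ge0 x; case: (hip x x) e => a b /= -> /andP[/= /eqP -> _]; by [].
Qed.

Lemma nsqZi H (a : R[i]) (x : H) :
  nsq (a *: x) = (complex.Re a ^+ 2 + complex.Im a ^+ 2) * nsq x.
Proof.
rewrite /nsq ripZil rip_iE (ripC x) (ripC x) scalerA !ripZil /rip /=.
have : complex.Im (hip x x) = 0.
  by have := hip_ge0 x; case: (hip x x) => ? ? /andP[/= /eqP].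
case: a => a b /=; case: (hip x x) => c d /= ->; ring.
Qed.

Lemma nsqN H (x : H) : nsq (- x) = nsq x.
Proof. by rewrite /nsq !ripE opprK. Qed.

Lemma hnormE H (x : H) : hnorm x = Num.sqrt (nsq x).
Proof. by []. Qed.

Lemma hnorm_ge0 H (x : H) : 0 <= hnorm x.
Proof. exact: sqrtr_ge0. Qed.

Lemma hnorm_sqr H (x : H) : hnorm x ^+ 2 = nsq x.
Proof. by rewrite hnormE sqr_sqrtr ?nsq_ge0. Qed.

Lemma ler_hnorm H K (x : H) (y : K) : (hnorm x <= hnorm y) = (nsq x <= nsq y).
Proof. by rewrite !hnormE ler_sqrt ?nsq_ge0. Qed.

Lemma hnorm_lt H (x : H) (e : R) : 0 < e -> (hnorm x < e) = (nsq x < e ^+ 2).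
Proof.
move=> e0; rewrite -hnorm_sqr ltr_pXn2r ?nnegrE ?hnorm_ge0 ?(ltW e0) //.
Qed.

Lemma hnorm0 H : hnorm (0 : H) = 0.
Proof. by rewrite hnormE /nsq rip0l sqrtr0. Qed.

Lemma hnorm_eq0 H (x : H) : hnorm x = 0 -> x = 0.
Proof. by move=> e; apply: nsq_eq0; rewrite -hnorm_sqr e expr0n. Qed.

Lemma hnormN H (x : H) : hnorm (- x) = hnorm x.
Proof. by rewrite !hnormE nsqN. Qed.

Lemma hnorm_distC H (x y : H) : hnorm (x - y) = hnorm (y - x).
Proof. by rewrite -hnormN opprB. Qed.

Lemma hnormZ H (t : R) (x : H) : 0 <= t -> hnorm (t%:C%C *: x) = t * hnorm x.
Proof.
move=> t0; rewrite !hnormE nsqZi /= expr0n addr0 sqrtrM ?sqr_ge0 //.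
by rewrite sqrtr_sqr ger0_norm.
Qed.

Lemma discriminant_le (e b c : R) : 0 <= c ->
  (forall t, 0 <= e + t * b *+ 2 + t ^+ 2 * c) -> b ^+ 2 <= e * c.
Proof.
move=> c0 h; have [c00|cn0] := eqVneq c 0.
  have [->|bn0] := eqVneq b 0; first by rewrite c00 mulr0 expr0n.
  (* With [c = 0] the polynomial is affine in [t], and this [t] gives it the value [-1]. *)
  have := h (- (e + 1) / (b *+ 2)).
  rewrite c00 mulr0 addr0 -mulrnAr divfK ?mulrn_eq0 //; lra.
have cp : 0 < c by rewrite lt_neqAle eq_sym cn0.
(* The minimiser of the quadratic polynomial. *)
have := h (- b / c).
have -> : e + - b / c * b *+ 2 + (- b / c) ^+ 2 * c = (e * c - b ^+ 2) / c.
  by field.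
by rewrite pmulr_lge0 ?invr_gt0 // subr_ge0.
Qed.

Lemma cauchy_schwarz H (x y : H) : rip x y ^+ 2 <= nsq x * nsq y.
Proof.
apply: discriminant_le => [|t]; first exact: nsq_ge0.
have := nsq_ge0 (x + t%:C%C *: y); rewrite /nsq !ripE (ripC y x).
by congr (_ <= _); ring.
Qed.

Lemma rip_le H (x y : H) : `|rip x y| <= hnorm x * hnorm y.
Proof.
rewrite -(@ler_pXn2r _ 2) ?nnegrE ?mulr_ge0 ?hnorm_ge0 //.
by rewrite real_normK ?num_real // exprMn !hnorm_sqr cauchy_schwarz.
Qed.

Lemma ler_hnormD H (x y : H) : hnorm (x + y) <= hnorm x + hnorm y.
Proof.
rewrite -(@ler_pXn2r _ 2) ?nnegrE ?addr_ge0 ?hnorm_ge0 //.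
rewrite hnorm_sqr /nsq !ripE (ripC y x) sqrrD !hnorm_sqr -/(nsq x) -/(nsq y).
have := le_trans (ler_norm _) (rip_le x y); lra.
Qed.

Lemma hnorm_dist H (x y z : H) : hnorm (x - z) <= hnorm (x - y) + hnorm (y - z).
Proof. by apply: le_trans (ler_hnormD _ _); rewrite addrA subrK. Qed.

Definition hcvg H (u : nat -> H) (l : H) := ip_cvg (@hip R H) u l.

Lemma hcvgP H (u : nat -> H) (l : H) : hcvg u l <->
  forall e : R, 0 < e -> exists N, forall n, (N <= n)%N -> hnorm (u n - l) < e.
Proof. by []. Qed.

Lemma hcvg_nsqP H (u : nat -> H) (l : H) : hcvg u l <->
  forall e : R, 0 < e -> exists N, forall n, (N <= n)%N -> nsq (u n - l) < e.
Proof.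
split=> h e e0.
  have [|N hN] := h (Num.sqrt e); first by rewrite sqrtr_gt0.
  exists N => n /hN; rewrite -/(hnorm _) hnorm_lt ?sqrtr_gt0 // sqr_sqrtr //.
  exact: ltW.
have [|N hN] := h (e ^+ 2); first by rewrite exprn_gt0.
by exists N => n /hN; rewrite -/(hnorm _) hnorm_lt.
Qed.

Lemma hcauchy_nsqP H (u : nat -> H) : ip_cauchy (@hip R H) u <->
  forall e : R, 0 < e -> exists N, forall m n, (N <= m)%N -> (N <= n)%N ->
    nsq (u m - u n) < e.
Proof.
split=> h e e0.
  have [|N hN] := h (Num.sqrt e); first by rewrite sqrtr_gt0.
  exists N => m n Nm Nn; have := hN m n Nm Nn.
  rewrite -/(hnorm _) hnorm_lt ?sqrtr_gt0 // sqr_sqrtr //; exact: ltW.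
have [|N hN] := h (e ^+ 2); first by rewrite exprn_gt0.
by exists N => m n Nm Nn; rewrite -/(hnorm _) hnorm_lt // hN.
Qed.

(** If [r] were positive, both errors would eventually be below [r / (A + B + 1)], and the bound
    would give [r < r]. This is how identities pass to limits. *)
Lemma hcvg_dist0 H K (u : nat -> H) (l : H) (v : nat -> K) (m : K) (A B r : R) :
  0 <= A -> 0 <= B -> hcvg u l -> hcvg v m ->
  (forall n, r <= A * hnorm (u n - l) + B * hnorm (v n - m)) -> r <= 0.
Proof.
move=> A0 B0 ul vm h; rewrite leNgt; apply/negP => r0.
have e0 : 0 < r / (A + B + 1) by rewrite divr_gt0 //; lra.
have [N1 h1] := (hcvgP _ _).1 ul _ e0.
have [N2 h2] := (hcvgP _ _).1 vm _ e0.
have := h (maxn N1 N2).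
have := h1 _ (leq_maxl N1 N2); have := h2 _ (leq_maxr N1 N2).
set a := hnorm _; set b := hnorm _ => lb la.
have hA := ler_wpM2l A0 (ltW la); have hB := ler_wpM2l B0 (ltW lb).
have re : r = (A + B + 1) * (r / (A + B + 1)) by field; rewrite lt0r_neq0 //; lra.
move: re e0 hA hB; set d := r / _; lra.
Qed.

(** Two controlling sequences are allowed so that limits of linear combinations and of compositions
    both follow from this one estimate. *)
Lemma hcvg_dom H K L (u : nat -> H) (l : H) (v : nat -> K) (m : K)
    (w : nat -> L) (k : L) (A B : R) :
  0 <= A -> 0 <= B -> hcvg u l -> hcvg v m ->
  (forall n, hnorm (w n - k) <= A * hnorm (u n - l) + B * hnorm (v n - m)) ->
  hcvg w k.
Proof.
move=> A0 B0 ul vm h; apply/hcvgP => e e0.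
have d0 : 0 < e / (A + B + 1) by rewrite divr_gt0 //; lra.
have [N1 h1] := (hcvgP _ _).1 ul _ d0.
have [N2 h2] := (hcvgP _ _).1 vm _ d0.
exists (maxn N1 N2) => n; rewrite geq_max => /andP[/h1 la /h2 lb].
apply: le_lt_trans (h n) _.
have hA := ler_wpM2l A0 (ltW la); have hB := ler_wpM2l B0 (ltW lb).
have re : e = (A + B + 1) * (e / (A + B + 1)) by field; rewrite lt0r_neq0 //; lra.
move: re d0 hA hB; set d := e / _; lra.
Qed.

Lemma hcvg_unique H (u : nat -> H) (l m : H) : hcvg u l -> hcvg u m -> l = m.
Proof.
move=> ul um; apply/eqP; rewrite -subr_eq0; apply/eqP/hnorm_eq0/le_anti.
rewrite hnorm_ge0 andbT; apply: (hcvg_dist0 ler01 ler01 ul um) => n.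
by rewrite !mul1r (hnorm_distC (u n) l) hnorm_dist.
Qed.

Lemma hcvg_cst H (l : H) : hcvg (fun=> l) l.
Proof. by apply/hcvgP => e e0; exists 0%N => n _; rewrite subrr hnorm0. Qed.

Definition hlin H K (f : H -> K) :=
  forall (a : R[i]) (x y : H), f (a *: x + y) = a *: f x + f y.

Lemma hlinD H K (f : H -> K) x y : hlin f -> f (x + y) = f x + f y.
Proof. by move=> lf; have := lf 1 x y; rewrite !scale1r. Qed.

Lemma hlin0 H K (f : H -> K) : hlin f -> f 0 = 0.
Proof. by move=> lf; apply: (@addrI _ (f 0)); rewrite -hlinD // !addr0. Qed.

Lemma hlinZ H K (f : H -> K) a x : hlin f -> f (a *: x) = a *: f x.
Proof. by move=> lf; rewrite -[_ *: x]addr0 lf hlin0 // addr0. Qed.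

Lemma hlinN H K (f : H -> K) x : hlin f -> f (- x) = - f x.
Proof. by move=> lf; rewrite -scaleN1r hlinZ // scaleN1r. Qed.

Lemma hlinB H K (f : H -> K) x y : hlin f -> f (x - y) = f x - f y.
Proof. by move=> lf; rewrite hlinD // hlinN. Qed.

End RealInnerProduct.

(** * Riesz representation on closed subspaces *)

Section Riesz.
Variable R : realType.
Implicit Types H K L : hilbert R.

Lemma invS_lt (e : R) : 0 < e ->
  exists N, forall n, (N <= n)%N -> n.+1%:R^-1 < e.
Proof.
move=> e0; exists (Num.bound e^-1) => n Nn.
have b := archi_boundP (ltW (etrans (invr_gt0 e) e0)).
rewrite invf_plt ?posrE ?ltr0n //; apply: lt_le_trans b _.
by rewrite ler_nat; apply: leq_trans Nn _.
Qed.

Record closed_subspace H (S : H -> Prop) : Prop := ClosedSubspace {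
  csub0 : S 0;
  csub_lin : forall a x y, S x -> S y -> S (a *: x + y);
  csub_cvg : forall u l, (forall n, S (u n)) -> hcvg u l -> S l }.

Lemma csubD H (S : H -> Prop) x y : closed_subspace S -> S x -> S y -> S (x + y).
Proof. by move=> cS Sx Sy; rewrite -[x]scale1r; apply: csub_lin. Qed.

Lemma csubZ H (S : H -> Prop) a x : closed_subspace S -> S x -> S (a *: x).
Proof. by move=> cS Sx; rewrite -[_ *: _]addr0; apply: csub_lin => //; apply: csub0. Qed.

(* The representing vector minimises [nsq s - 2 phi s] over [S]; near-minimisers
   are Cauchy by the parallelogram law. *)
Lemma riesz_on_subspace H (S : H -> Prop) (phi : H -> R) (c : R) :
  closed_subspace S ->
  (forall t x y, phi (t%:C%C *: x + y) = t * phi x + phi y) ->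
  (forall s, S s -> c <= nsq s - phi s *+ 2) ->
  exists2 p, S p & forall s, S s -> rip p s = phi s.
Proof.
move=> cS lphi lb; pose F s := nsq s - phi s *+ 2.
have phiD x y : phi (x + y) = phi x + phi y.
  by have := lphi 1 x y; rewrite scale1r mul1r.
have phi0 : phi 0 = 0 by have := phiD 0 0; rewrite addr0; lra.
have phiZ t x : phi (t%:C%C *: x) = t * phi x.
  by have := lphi t x 0; rewrite addr0 phi0 addr0.
pose A : set R := (F @` S)%classic.
have hA : has_inf A.
  split; first by exists (F 0); exists 0 => //; exact: csub0.
  by exists c => _ [s Ss <-]; apply: lb.
have dle s : S s -> inf A <= F s by move=> Ss; apply: ge_inf; [case: hA | exists s].
have /choice[u uP] n : exists s, S s /\ F s < inf A + n.+1%:R^-1.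
  have [|_ [s Ss <-] lts] := inf_adherent (eps := n.+1%:R^-1) _ hA.
    by rewrite invr_gt0 ltr0n.
  by exists s.
have /hcomplete[l ul] : ip_cauchy (@hip R H) u.
  apply/hcauchy_nsqP => e e0; have [|N hN] := @invS_lt (e / 4); first lra.
  exists N => m n /hN hm /hN hn.
  have [Sm Fm] := uP m; have [Sn Fn] := uP n.
  (* With [w] the midpoint, [nsq (u m - u n)] equals [2 F (u m) + 2 F (u n) - 4 F w], hence is below
     [2 / (m + 1) + 2 / (n + 1) < e]. *)
  have := dle _ (csubZ (2^-1)%:C%C cS (csubD cS Sm Sn)).
  rewrite /F /nsq phiZ phiD !ripE in Fm Fn *.
  move: hm hn Fm Fn; rewrite (ripC (u n) (u m)).
  set a := m.+1%:R^-1; set b := n.+1%:R^-1; lra.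
have Sl : S l by apply: (csub_cvg cS _ ul) => n; case: (uP n).
exists l => // s Ss.
(* Moving [u n] by [t s] lowers [F] by at most [1 / (n + 1)] for every real [t]; the discriminant of
   this quadratic in [t] gives the bound. *)
have near n : (rip (u n) s - phi s) ^+ 2 <= n.+1%:R^-1 * nsq s.
  have [Sn Fn] := uP n; apply: discriminant_le => [|t]; first exact: nsq_ge0.
  have := dle _ (csub_lin cS t%:C%C Ss Sn).
  rewrite /F /nsq lphi !ripE (ripC s (u n)) in Fn *; move: Fn.
  set d := _^-1; nra.
apply/eqP; rewrite -subr_eq0 -sqrf_eq0; apply/eqP/le_anti; rewrite sqr_ge0 andbT.
rewrite leNgt; apply/negP; set r := _ ^+ 2 => r0.
have s0 := nsq_ge0 s.
(* With [x], [y], [z] as set below, [r = (y - z)^2 <= 2 (x - y)^2 + 2 (x - z)^2]. Each square on the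
   right is at most [d * nsq s], so [r <= 4 d * nsq s < r]. *)
have d0 : 0 < r / (4 * (nsq s + 1)) by rewrite divr_gt0 // mulr_gt0 //; lra.
have [N1 h1] := (hcvg_nsqP _ _).1 ul _ d0.
have [N2 h2] := invS_lt d0.
have /ltW a1 := h1 _ (leq_maxl N1 N2); have /ltW a2 := h2 _ (leq_maxr N1 N2).
have b1 := le_trans (cauchy_schwarz _ _) (ler_wpM2r s0 a1).
have b2 := le_trans (near _) (ler_wpM2r s0 a2).
have er : r = 4 * (nsq s + 1) * (r / (4 * (nsq s + 1))).
  by field; rewrite lt0r_neq0 //; lra.
move: b1 b2 er d0; set d := r / _; rewrite /r !ripE.
set x := rip (u _) s; set y := rip l s; set z := phi s.
have := sqr_ge0 (x *+ 2 - y - z); nra.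
Qed.

End Riesz.

(** * Operator square roots and the defect operator *)

Section DefectOperator.
Local Open Scope classical_set_scope.
Variable R : realType.
Implicit Types H K L : hilbert R.

Lemma rip_inj H (x y : H) : (forall s, rip x s = rip y s) -> x = y.
Proof.
move=> h; apply/eqP; rewrite -subr_eq0; apply/eqP/nsq_eq0.
by rewrite /nsq ripDl ripNl h subrr.
Qed.

Lemma whole_closed_subspace H : closed_subspace (fun _ : H => True).
Proof. by []. Qed.

(* [sqrt_approx A n] and its scalar majorant [sqrt_bound n] iterate
   [B := (A + B^2) / 2], whose fixed points satisfy [(1 - B)^2 = 1 - A]. *)
Definition sqrt_bound (n : nat) : R := iter n (fun t => (1 + t ^+ 2) / 2) 0.

Definition sqrt_approx H (A : H -> H) (n : nat) : H -> H :=
  iter n (fun B x => (2^-1)%:C%C *: (A x + B (B x))) (fun=> 0).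

Lemma sqrt_bound_itv n : 0 <= sqrt_bound n <= 1.
Proof.
elim: n => [|n]; first by rewrite /sqrt_bound /= lexx ler01.
rewrite /sqrt_bound iterS -/(sqrt_bound n).
by set t := sqrt_bound n => /andP[t0 t1]; apply/andP; split; nra.
Qed.

Lemma sqrt_boundS n : sqrt_bound n <= sqrt_bound n.+1.
Proof.
rewrite /sqrt_bound iterS -/(sqrt_bound n).
have := sqr_ge0 (sqrt_bound n - 1); set t := sqrt_bound n; nra.
Qed.

Lemma sqrt_bound_cauchy (e : R) : 0 < e ->
  exists N, forall n, (N <= n)%N -> sqrt_bound n - sqrt_bound N < e.
Proof.
move=> e0; pose A : set R := range sqrt_bound.
have hA : has_sup A.
  split; first by exists (sqrt_bound 0), 0%N.
  by exists 1 => _ [n _ <-]; case/andP: (sqrt_bound_itv n).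
have [_ [N _ <-] hN] := sup_adherent e0 hA.
exists N => n _.
have : sqrt_bound n <= sup A by apply: ub_le_sup; [case: hA | exists n].
by move: hN; set a := sqrt_bound N; set b := sqrt_bound n; lra.
Qed.

Section SquareRoot.
Variables (H : hilbert R) (A : H -> H).
Hypotheses (linA : hlin A) (symA : forall x y, rip (A x) y = rip x (A y))
  (A_le : forall x, hnorm (A x) <= hnorm x).

Local Notation Y := (sqrt_approx A).
Local Notation y := sqrt_bound.

Let YS n x : Y n.+1 x = (2^-1)%:C%C *: (A x + Y n (Y n x)).
Proof. by []. Qed.

Let yS n : y n.+1 = (1 + y n ^+ 2) / 2.
Proof. by []. Qed.

Let y0 n : 0 <= y n. Proof. by case/andP: (sqrt_bound_itv n). Qed.

Let half_ge0 : 0 <= 2^-1 :> R. Proof. by rewrite invr_ge0. Qed.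

Lemma sqrt_approx_lin n : hlin (Y n).
Proof.
elim: n => [|n IH] a x z; first by rewrite /sqrt_approx /= scaler0 addr0.
rewrite !YS linA !IH addrACA -scalerDr [LHS]scalerDr.
by congr (_ + _); rewrite !scalerA mulrC.
Qed.

Lemma sqrt_approx_sym n x z : rip (Y n x) z = rip x (Y n z).
Proof.
elim: n x z => [|n IH] x z; first by rewrite /sqrt_approx /= !ripE.
by rewrite !YS !ripE symA !IH.
Qed.

Lemma sqrt_approx_le n x : hnorm (Y n x) <= y n * hnorm x.
Proof.
elim: n x => [|n IH] x; first by rewrite /sqrt_approx /= hnorm0 /y /= mul0r.
rewrite YS yS hnormZ //.
have h1 := ler_hnormD (A x) (Y n (Y n x)).
have h2 := le_trans (IH (Y n x)) (ler_wpM2l (y0 n) (IH x)).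
have := A_le x; move: h1 h2; rewrite mulrA -expr2; lra.
Qed.

(** Writing [B' = Y n.+1] and [B = Y n], the difference [B'^2 - B^2] is [B' (B' - B) + (B' - B) B],
    an identity that needs no commutation. Its norm bound is the matching factorisation of the
    difference of squares of the scalar majorants. *)
Lemma sqrt_approx_step n x :
  hnorm (Y n.+1 x - Y n x) <= (y n.+1 - y n) * hnorm x.
Proof.
elim: n x => [|n IH] x.
  have -> : Y 1 x - Y 0 x = (2^-1)%:C%C *: A x.
    by rewrite YS /sqrt_approx /= subr0 addr0.
  have -> : y 1 - y 0 = 2^-1 by rewrite yS /sqrt_bound /=; field.
  by rewrite hnormZ // ler_wpM2l.
have -> : Y n.+2 x - Y n.+1 x = (2^-1)%:C%C *:
    (Y n.+1 (Y n.+1 x - Y n x) + (Y n.+1 (Y n x) - Y n (Y n x))).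
  rewrite YS [in X in _ - X]YS -scalerBr; congr (_ *: _).
  rewrite (hlinB _ _ (@sqrt_approx_lin n.+1)) addrA subrK.
  by rewrite opprD addrACA subrr add0r.
rewrite hnormZ //.
have h1 := ler_hnormD (Y n.+1 (Y n.+1 x - Y n x)) (Y n.+1 (Y n x) - Y n (Y n x)).
have h2 := le_trans (sqrt_approx_le _ _) (ler_wpM2l (y0 n.+1) (IH x)).
have d0 : 0 <= y n.+1 - y n by rewrite subr_ge0 sqrt_boundS.
have h3 := le_trans (IH (Y n x)) (ler_wpM2l d0 (sqrt_approx_le n x)).
have -> : y n.+2 - y n.+1 = 2^-1 * ((y n.+1 + y n) * (y n.+1 - y n)).
  by rewrite {1}yS [X in _ - X]yS; field.
rewrite -!mulrA ler_wpM2l //; apply: le_trans h1 _.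
apply: le_trans (lerD h2 h3) _.
by rewrite le_eqVlt; apply/orP; left; apply/eqP; ring.
Qed.

Lemma sqrt_approx_dist n m x : (n <= m)%N ->
  hnorm (Y m x - Y n x) <= (y m - y n) * hnorm x.
Proof.
move=> /subnKC <-; elim: (m - n)%N => [|k IH].
  by rewrite addn0 !subrr hnorm0 mul0r.
rewrite addnS; apply: le_trans (hnorm_dist _ (Y (n + k) x) _) _.
apply: le_trans (lerD (sqrt_approx_step _ _) IH) _.
by rewrite -mulrDl addrA subrK.
Qed.

Lemma sqrt_approx_cvg x : exists l, hcvg (Y ^~ x) l.
Proof.
apply: hcomplete => e e0; rewrite -/(hnorm _).
have x0 := hnorm_ge0 x.
have d0 : 0 < e / (2 * (hnorm x + 1)) by rewrite divr_gt0 // mulr_gt0 //; lra.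
have [N hN] := sqrt_bound_cauchy d0.
exists N => m n Nm Nn; rewrite -/(hnorm _).
have := hnorm_dist (Y m x) (Y N x) (Y n x); rewrite (hnorm_distC (Y N x)).
have := le_trans (sqrt_approx_dist x Nm) (ler_wpM2r x0 (ltW (hN m Nm))).
have := le_trans (sqrt_approx_dist x Nn) (ler_wpM2r x0 (ltW (hN n Nn))).
have er : e = 2 * (hnorm x + 1) * (e / (2 * (hnorm x + 1))).
  by field; rewrite lt0r_neq0 //; lra.
move: er d0; set d := e / _; nra.
Qed.

(** The operator [B] is the pointwise limit of the iterates, which are Cauchy because their scalar
    majorants are; the last clause says that [1 - B] squares to [1 - A]. *)
Lemma sqrt_limit : exists B : H -> H, [/\ hlin B,
  forall x z, rip (B x) z = rip x (B z) &
  forall x, B (B x) = B x + B x - A x].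
Proof.
have /choice[B BP] := sqrt_approx_cvg.
have y1 n : y n <= 1 by case/andP: (sqrt_bound_itv n).
have Y_le n x : hnorm (Y n x) <= hnorm x.
  by apply: le_trans (sqrt_approx_le n x) _; rewrite ler_piMl ?hnorm_ge0.
have linB : hlin B.
  move=> a x z; apply: hcvg_unique (BP _) _.
  (* The modulus of [a]. *)
  pose c := Num.sqrt (complex.Re a ^+ 2 + complex.Im a ^+ 2).
  apply: (hcvg_dom (sqrtr_ge0 _ : 0 <= c) ler01 (BP x) (BP z)) => n.
  rewrite sqrt_approx_lin opprD addrACA -scalerBr.
  apply: le_trans (ler_hnormD _ _) _; rewrite mul1r.
  by rewrite {1}hnormE nsqZi sqrtrM ?addr_ge0 ?sqr_ge0.
exists B; split=> // [x z|x].
  apply/eqP; rewrite -subr_eq0 -normr_le0.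
  have := hcvg_dist0 (hnorm_ge0 z) (hnorm_ge0 x) (BP x) (BP z).
  apply=> n.
  have -> : rip (B x) z - rip x (B z) = rip (B x - Y n x) z + rip x (Y n z - B z).
    by rewrite !ripE sqrt_approx_sym; ring.
  apply: le_trans (ler_normD _ _) _.
  apply: lerD; apply: le_trans (rip_le _ _) _ => //.
  by rewrite mulrC (hnorm_distC (B x)).
have c1 : hcvg (fun n => Y n (Y n x)) (B (B x)).
  apply: (hcvg_dom ler01 ler01 (BP x) (BP (B x))) => n; rewrite !mul1r.
  apply: le_trans (hnorm_dist _ (Y n (B x)) _) _.
  by rewrite lerD2r -(hlinB _ _ (@sqrt_approx_lin n)).
have c2 : hcvg (fun n => Y n.+1 x) (B x).
  by move=> e /(BP x)[N hN]; exists N => n Nn; apply/hN/leqW.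
apply: hcvg_unique c1 _.
(* By the recursion, [Y n (Y n x)] is [2 Y n.+1 x - A x], so its error is twice that of the shifted
   sequence; a constant sequence fills the second slot. *)
apply: (hcvg_dom (ler0n _ 2) ler01 c2 (hcvg_cst (0 : H))) => n.
rewrite subrr hnorm0 mulr0 addr0 -hnormZ //.
rewrite le_eqVlt; apply/orP; left; apply/eqP; congr (hnorm _).
rewrite YS scalerBr scalerA -rmorphM divff ?pnatr_eq0 // scale1r.
by rewrite rmorph_nat scaler_nat mulr2n opprB addrA [Y n _ + _]addrC.
Qed.

End SquareRoot.

(** Riesz representation supplies [A], which is the adjoint of [T] composed with [T]. Then
    [D = 1 - B] is symmetric with [D^2 = 1 - A], so [nsq (D x)] is the product of [x - A x] with
    [x]. *)
Lemma defect_operator H (T : H -> H) : hlin T ->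
  (forall x, hnorm (T x) <= hnorm x) ->
  exists2 D : H -> H, hlin D & forall x, nsq (D x) = nsq x - nsq (T x).
Proof.
move=> linT T_le.
have /choice[A AP] x : exists z, forall s, rip z s = rip (T x) (T s).
  have [||z _ h] := riesz_on_subspace (phi := fun s => rip (T x) (T s))
    (* The bound comes from [nsq s >= nsq (T s)] and completing the square in [T s - T x]. *)
    (c := - nsq (T x)) (whole_closed_subspace H).
  - by move=> t u v; rewrite linT !ripE.
  - move=> s _; have := T_le s; rewrite ler_hnorm.
    have := nsq_ge0 (T s - T x); rewrite /nsq !ripE (ripC (T x)); lra.
  - by exists z => s; apply: h.
have linA : hlin A.
  move=> a x z; apply: rip_inj => s.
  rewrite AP linT !ripDl !ripZil !rip_iE !AP; congr (_ - _ * rip _ _ + _).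
  by rewrite hlinZ.
have symA x z : rip (A x) z = rip x (A z) by rewrite AP (ripC x) AP ripC.
have A_le x : hnorm (A x) <= hnorm x.
  have [->|n0] := eqVneq (hnorm (A x)) 0; first exact: hnorm_ge0.
  have p0 : 0 < hnorm (A x) by rewrite lt_neqAle eq_sym n0 hnorm_ge0.
  rewrite -(ler_pM2r p0) -expr2 hnorm_sqr /nsq AP.
  apply: le_trans (ler_norm _) (le_trans (rip_le _ _) _).
  by apply: ler_pM; rewrite ?hnorm_ge0.
have [B [linB symB BB]] := sqrt_limit linA symA A_le.
exists (fun x => x - B x) => [a x z|x].
  by rewrite linB opprD addrACA scalerBr.
rewrite /nsq !ripE -(symB (B x) x) BB !ripE AP (ripC x (B x)); lra.
Qed.

End DefectOperator.


(** * Complex Hilbert spaces from real forms invariant under [i] *)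

Section HilbertOfForm.
Variables (R : realType) (V : lmodType R[i]) (r : V -> V -> R).
Hypotheses (rDl : forall x y z, r (x + y) z = r x z + r y z)
  (rZl : forall (t : R) x z, r (t%:C%C *: x) z = t * r x z)
  (rC : forall x y, r x y = r y x)
  (rii : forall x y, r ('i%C *: x) ('i%C *: y) = r x y)
  (r_ge0 : forall x, 0 <= r x x)
  (r_eq0 : forall x, r x x = 0 -> x = 0)
  (r_complete : forall u : nat -> V,
    (forall e, 0 < e -> exists N, forall m n, (N <= m)%N -> (N <= n)%N ->
      r (u m - u n) (u m - u n) < e) ->
    exists l, forall e, 0 < e -> exists N, forall n, (N <= n)%N ->
      r (u n - l) (u n - l) < e).

(** A product linear in its first slot turns a factor [i] in the second slot into [-i], so its
    imaginary part at [(x, y)] is its real part at [(x, i y)]. *)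
Definition form_hip (x y : V) : R[i] := (r x y +i* r x ('i%C *: y))%C.

Let mulii : 'i%C * 'i%C = (-1)%:C%C :> R[i].
Proof. by apply/eqP; rewrite eq_complex /= !(mul0r, mulr0, mulr1, addr0, add0r) !eqxx. Qed.

Let form_il x y : r ('i%C *: x) y = - r x ('i%C *: y).
Proof. by rewrite -rii scalerA mulii rZl mulN1r. Qed.

Lemma form_hip_linear (a : R[i]) (x y z : V) :
  form_hip (a *: x + y) z = a * form_hip x z + form_hip y z.
Proof.
have key w : r (a *: x + y) w =
    complex.Re a * r x w - complex.Im a * r x ('i%C *: w) + r y w.
  rewrite rDl; congr (_ + _); case: a => s t /=.
  have -> : (s +i* t)%C *: x = s%:C%C *: x + t%:C%C *: ('i%C *: x).
    rewrite scalerA -scalerDl; congr (_ *: _); apply/eqP.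
    by rewrite eq_complex /= !(mul0r, mulr0, mulr1, addr0, add0r, subr0) !eqxx.
  by rewrite rDl !rZl form_il mulrN.
have iiw w : r x ('i%C *: ('i%C *: w)) = - r x w.
  by rewrite scalerA mulii rC rZl mulN1r rC.
rewrite /form_hip !key iiw; case: a key => s t _ /=.
apply/eqP; rewrite eq_complex /=; apply/andP; split; apply/eqP; ring.
Qed.

Lemma form_hip_sym (x y : V) : form_hip y x = conjc (form_hip x y).
Proof. by rewrite /form_hip /= (rC y x) (rC y ('i%C *: x)) form_il. Qed.

Lemma form_hip_diag (x : V) : form_hip x x = (r x x)%:C%C.
Proof.
rewrite /form_hip; congr (_ +i* _)%C.
by have := form_il x x; rewrite rC; lra.
Qed.

Lemma form_hip_ge0 (x : V) : 0 <= form_hip x x.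
Proof. by rewrite form_hip_diag lecR. Qed.

Lemma form_hip_eq0 (x : V) : form_hip x x = 0 -> x = 0.
Proof. by rewrite form_hip_diag => -[/r_eq0]. Qed.

Lemma form_hip_complete (u : nat -> V) : ip_cauchy form_hip u ->
  exists l, ip_cvg form_hip u l.
Proof.
move=> cu; have [e e0|l hl] := @r_complete u.
  have [|N hN] := cu (Num.sqrt e); first by rewrite sqrtr_gt0.
  by exists N => m n Nm Nn; have := hN m n Nm Nn; rewrite /ip_norm /= ltr_sqrt.
exists l => e e0; have [|N hN] := hl (e ^+ 2); first by rewrite exprn_gt0.
exists N => n /hN h; rewrite /ip_norm /=.
by rewrite -(ger0_norm (ltW e0)) -sqrtr_sqr ltr_sqrt // exprn_gt0.
Qed.

Definition hilbert_of_form : hilbert R :=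
  Hilbert form_hip_linear form_hip_sym form_hip_ge0 form_hip_eq0
    form_hip_complete.

End HilbertOfForm.

(** * Orthogonal sum of two Hilbert spaces *)

Section Product.
Variables (R : realType) (H K : hilbert R).

Definition prod_form (x y : (H * K)%type) : R := rip x.1 y.1 + rip x.2 y.2.

Let pD x y z : prod_form (x + y) z = prod_form x z + prod_form y z.
Proof. by rewrite /prod_form !ripDl addrACA. Qed.

Let pZ (t : R) x z : prod_form (t%:C%C *: x) z = t * prod_form x z.
Proof. by rewrite /prod_form !ripZl mulrDr. Qed.

Let pC x y : prod_form x y = prod_form y x.
Proof. by rewrite /prod_form !(ripC x.1, ripC x.2). Qed.

Let pii x y : prod_form ('i%C *: x) ('i%C *: y) = prod_form x y.
Proof. by rewrite /prod_form !ripii. Qed.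

Let p_ge0 x : 0 <= prod_form x x.
Proof. by rewrite addr_ge0 // nsq_ge0. Qed.

Let p_eq0 x : prod_form x x = 0 -> x = 0.
Proof.
move/eqP; rewrite paddr_eq0 ?nsq_ge0 // => /andP[/eqP/nsq_eq0 x1 /eqP/nsq_eq0 x2].
by case: x x1 x2 => a b /= -> ->.
Qed.

Let p_complete (u : nat -> (H * K)%type) :
  (forall e, 0 < e -> exists N, forall m n, (N <= m)%N -> (N <= n)%N ->
    prod_form (u m - u n) (u m - u n) < e) ->
  exists l, forall e, 0 < e -> exists N, forall n, (N <= n)%N ->
    prod_form (u n - l) (u n - l) < e.
Proof.
move=> cu.
have /hcomplete[l1 /hcvg_nsqP h1] : ip_cauchy (@hip R H) (fun n => (u n).1).
  apply/hcauchy_nsqP => e /cu[N hN]; exists N => m n Nm Nn.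
  by apply: le_lt_trans (hN m n Nm Nn); rewrite lerDl nsq_ge0.
have /hcomplete[l2 /hcvg_nsqP h2] : ip_cauchy (@hip R K) (fun n => (u n).2).
  apply/hcauchy_nsqP => e /cu[N hN]; exists N => m n Nm Nn.
  by apply: le_lt_trans (hN m n Nm Nn); rewrite lerDr nsq_ge0.
exists (l1, l2) => e e0; have e2 : 0 < e / 2 by lra.
have [[N1 k1] [N2 k2]] := (h1 _ e2, h2 _ e2).
exists (maxn N1 N2) => n; rewrite geq_max => /andP[/k1 a /k2 b].
by rewrite [e]splitr ltrD.
Qed.

Definition hprod : hilbert R := hilbert_of_form pD pZ pC pii p_ge0 p_eq0 p_complete.

Lemma rip_prod (x y : hprod) : rip x y = rip x.1 y.1 + rip x.2 y.2.
Proof. by []. Qed.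

Lemma nsq_prod (x : hprod) : nsq x = nsq x.1 + nsq x.2.
Proof. by []. Qed.

End Product.

(** * Square-summable sequences in a Hilbert space *)

Section SquareSummable.
Local Open Scope classical_set_scope.
Variables (R : realType) (H : hilbert R).

Definition l2bounded (f : nat -> H) :=
  exists M : R, forall N, \sum_(n < N) nsq (f n) <= M.

Definition l2pred : {pred nat -> H} := fun f => `[< l2bounded f >].

Lemma nsq_scaleD_le (a : R[i]) (x y : H) :
  nsq (a *: x + y) <= (complex.Re a ^+ 2 + complex.Im a ^+ 2) * nsq x *+ 2 + nsq y *+ 2.
Proof.
rewrite -nsqZi; have := nsq_ge0 (a *: x - y).
by rewrite /nsq !ripE (ripC y); lra.
Qed.

Lemma l2bounded_lin a f g : l2bounded f -> l2bounded g -> l2bounded (a *: f + g).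
Proof.
move=> [M hM] [P hP]; set c := complex.Re a ^+ 2 + complex.Im a ^+ 2.
exists (c * M *+ 2 + P *+ 2) => N.
have c0 : 0 <= c by rewrite addr_ge0 ?sqr_ge0.
apply: (@le_trans _ _ (\sum_(n < N) (c * nsq (f n) *+ 2 + nsq (g n) *+ 2))).
  by apply: ler_sum => n _; exact: nsq_scaleD_le.
rewrite big_split /= !sumrMnl -mulr_sumr.
by apply: lerD; rewrite lerMn2r; apply/orP; right; rewrite ?ler_wpM2l ?hM ?hP.
Qed.

Lemma l2pred_submod : submod_closed l2pred.
Proof.
split.
  apply/asboolP; exists 0 => N; rewrite big1 // => n _.
  by rewrite /nsq rip0l.
by move=> a f g /asboolP bf /asboolP bg; apply/asboolP/l2bounded_lin.
Qed.

HB.instance Definition _ :=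
  GRing.isSubmodClosed.Build _ _ l2pred l2pred_submod.

Record l2 := L2 { l2val :> nat -> H; l2P : l2val \in l2pred }.
HB.instance Definition _ := [isSub for l2val].
HB.instance Definition _ := [Choice of l2 by <:].
HB.instance Definition _ := [SubChoice_isSubLmodule of l2 by <:].


Lemma l2_bounded (f : l2) : l2bounded f.
Proof. exact/asboolP/l2P. Qed.

Lemma l2_eq (f g : l2) : (forall n, f n = g n) -> f = g.
Proof. by move=> h; apply/val_inj/funext. Qed.

Definition psum (f g : l2) (N : nat) : R := \sum_(n < N) rip (f n) (g n).

Lemma psum_nondecreasing (f : l2) : nondecreasing_seq (psum f f).
Proof.
apply/nondecreasing_seqP => N.
by rewrite /psum big_ord_recr /= lerDl nsq_ge0.
Qed.

Lemma psum_diag_cvg (f : l2) : cvgn (psum f f).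
Proof.
apply: nondecreasing_is_cvgn; first exact: psum_nondecreasing.
by have [M hM] := l2_bounded f; exists M => _ [N _ <-]; apply: hM.
Qed.

(** Polarisation writes the mixed partial sums through three diagonal ones, which are nondecreasing
    and bounded. *)
Lemma psum_cvg (f g : l2) : cvgn (psum f g).
Proof.
have -> : psum f g =
    (fun N => 2^-1 * (psum (f + g) (f + g) N - psum f f N - psum g g N)).
  apply/funext => N; rewrite /psum -!sumrB mulr_sumr; apply: eq_bigr => n _.
  have -> : (f + g : l2) n = f n + g n by [].
  by rewrite !ripE (ripC (g n)); field.
apply: is_cvgM; first exact: is_cvg_cst.
by do 2?apply: is_cvgB; exact: psum_diag_cvg.
Qed.

Definition l2form (f g : l2) : R := limn (psum f g).

Lemma psum_le_l2form (f : l2) N : psum f f N <= l2form f f.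
Proof.
apply: nondecreasing_cvgn_le; [exact: psum_nondecreasing | exact: psum_cvg].
Qed.

Lemma l2form_le (f : l2) (M : R) : (forall N, psum f f N <= M) -> l2form f f <= M.
Proof. by move=> h; apply: limr_le; [exact: psum_cvg | exact: nearW]. Qed.

Let lD f g h : l2form (f + g) h = l2form f h + l2form g h.
Proof.
rewrite /l2form -limD; [|exact: psum_cvg|exact: psum_cvg].
congr (limn _); apply/funext => N; rewrite /psum /GRing.add /= -big_split /=.
by apply: eq_bigr => n _; exact: ripDl.
Qed.

Let lZ (t : R) f h : l2form (t%:C%C *: f) h = t * l2form f h.
Proof.
apply: cvg_lim => //.
have -> : psum (t%:C%C *: f) h = (fun N => t * psum f h N).
  by apply/funext => N; rewrite /psum mulr_sumr; apply: eq_bigr => n _; exact: ripZl.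
by apply: cvgM; [exact: cvg_cst | exact: psum_cvg].
Qed.

Let lC f g : l2form f g = l2form g f.
Proof.
by congr (limn _); apply/funext => N; apply: eq_bigr => n _; rewrite ripC.
Qed.

Let lii f g : l2form ('i%C *: f) ('i%C *: g) = l2form f g.
Proof.
by congr (limn _); apply/funext => N; apply: eq_bigr => n _; exact: ripii.
Qed.

Let l_ge0 f : 0 <= l2form f f.
Proof. by apply: le_trans (psum_le_l2form f 0); rewrite /psum big_ord0. Qed.

Lemma nsq_le_l2form (f : l2) n : nsq (f n) <= l2form f f.
Proof.
apply: le_trans (psum_le_l2form f n.+1).
by rewrite /psum big_ord_recr /= lerDr; apply: sumr_ge0 => i _; exact: nsq_ge0.
Qed.

Let l_eq0 f : l2form f f = 0 -> f = 0.
Proof.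
move=> e; apply: l2_eq => n; apply/nsq_eq0/le_anti.
by rewrite nsq_ge0 andbT -e nsq_le_l2form.
Qed.

Lemma psum_cvg0 (u : nat -> nat -> H) (l : nat -> H) :
  (forall n, hcvg (u ^~ n) (l n)) -> forall N e, 0 < e ->
  exists K, forall k, (K <= k)%N -> \sum_(n < N) nsq (u k n - l n) < e.
Proof.
move=> h; elim=> [|N IH] e e0.
  by exists 0%N => k _; rewrite big_ord0.
have e2 : 0 < e / 2 by lra.
have [K1 h1] := IH _ e2; have [K2 h2] := (hcvg_nsqP _ _).1 (h N) _ e2.
exists (maxn K1 K2) => k; rewrite geq_max => /andP[/h1 a /h2 b].
by rewrite big_ord_recr /= [e]splitr ltrD.
Qed.

Let l_complete (u : nat -> l2) :
  (forall e, 0 < e -> exists N, forall m n, (N <= m)%N -> (N <= n)%N ->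
    l2form (u m - u n) (u m - u n) < e) ->
  exists l, forall e, 0 < e -> exists N, forall n, (N <= n)%N ->
    l2form (u n - l) (u n - l) < e.
Proof.
move=> cu.
have /choice[l lP] n : exists l, hcvg (fun k => u k n) l.
  apply: hcomplete; apply/hcauchy_nsqP => e /cu[N hN]; exists N => p k Np Nk.
  exact: le_lt_trans (nsq_le_l2form (u p - u k) n) (hN p k Np Nk).
(* For a fixed truncation [P], compare with some [u k] whose first [P] coordinates are already close
   to [l]. The index [k] depends on [P] but the resulting bound does not. *)
have key e : 0 < e -> exists N, forall m, (N <= m)%N ->
    forall P, \sum_(n < P) nsq (u m n - l n) <= e.
  move=> e0; have e4 : 0 < e / 4 by lra.
  have [N hN] := cu _ e4; exists N => m Nm P.
  have [K hK] := psum_cvg0 lP P e4.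
  have /ltW a := hK _ (leq_maxr N K).
  have /ltW := hN m _ Nm (leq_maxl N K); move: (maxn N K) a => k a.
  move=> /(le_trans (psum_le_l2form _ P)) b.
  apply: (@le_trans _ _ (\sum_(n < P)
      (nsq (u m n - u k n) *+ 2 + nsq (u k n - l n) *+ 2))).
    apply: ler_sum => n _.
    have := nsq_ge0 ((u m n - u k n) - (u k n - l n)).
    have -> : u m n - l n = (u m n - u k n) + (u k n - l n) by rewrite addrA subrK.
    move: (u m n - u k n) (u k n - l n) => x y.
    by rewrite /nsq !ripE (ripC y x); lra.
  rewrite big_split /= !sumrMnl.
  have b' : \sum_(n < P) nsq (u m n - u k n) <= e / 4 by exact: b.
  by move: a b'; lra.
(* The limit is [u m - (u m - l)], a combination of two square-summable sequences. *)
have ul m : l2bounded (fun n => u m n - l n) -> l2bounded l.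
  move=> b; have := l2bounded_lin (-1) b (l2_bounded (u m)).
  congr l2bounded; apply/funext => n.
  by rewrite /GRing.add /= /GRing.scale /= scaleN1r opprB subrK.
have [N0 h0] := key 1 ltr01.
have lb : l2bounded l by apply: (ul N0); exists 1 => P; exact: h0.
exists (@L2 l (asboolT lb)) => e e0.
have e2 : 0 < e / 2 by lra.
have [N hN] := key _ e2; exists N => n Nn.
by apply: (@le_lt_trans _ _ (e / 2)); [apply: l2form_le => P; exact: hN | lra].
Qed.

Definition hl2 : hilbert R := hilbert_of_form lD lZ lC lii l_ge0 l_eq0 l_complete.

Lemma nsq_hl2 (f : hl2) : nsq f = l2form f f.
Proof. by []. Qed.

End SquareSummable.

(** * Extending an isometry between subspaces to a unitary *)

Section PartialIsometry.
Variable R : realType.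
Implicit Types H E : hilbert R.

Definition range_closure H E (Z : H -> E) (p : E) : Prop :=
  forall e : R, 0 < e -> exists h, hnorm (Z h - p) < e.

Lemma range_closureP H E (Z : H -> E) h : range_closure Z (Z h).
Proof. by move=> e e0; exists h; rewrite subrr hnorm0. Qed.

Lemma range_closure_closed H E (Z : H -> E) : hlin Z ->
  closed_subspace (range_closure Z).
Proof.
move=> linZ; split.
- by move=> e e0; exists 0; rewrite hlin0 // subrr hnorm0.
- move=> a x y hx hy e e0.
  pose c := Num.sqrt (complex.Re a ^+ 2 + complex.Im a ^+ 2).
  have c0 : 0 <= c by exact: sqrtr_ge0.
  have d0 : 0 < e / (c + 1) by rewrite divr_gt0 //; lra.
  have [[h1 /ltW k1] [h2 k2]] := (hx _ d0, hy _ d0).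
  exists (a *: h1 + h2); rewrite linZ opprD addrACA -scalerBr.
  apply: le_lt_trans (ler_hnormD _ _) _.
  have -> : hnorm (a *: (Z h1 - x)) = c * hnorm (Z h1 - x).
    by rewrite !hnormE nsqZi sqrtrM ?addr_ge0 ?sqr_ge0.
  have er : e = (c + 1) * (e / (c + 1)) by field; rewrite lt0r_neq0 //; lra.
  have := ler_wpM2l c0 k1; move: er k2; set d := e / _; nra.
- move=> u l hu /hcvgP ul e e0; have e2 : 0 < e / 2 by lra.
  have [N hN] := ul _ e2; have [h hh] := hu N _ e2.
  exists h; apply: le_lt_trans (hnorm_dist _ (u N) _) _.
  by rewrite [e]splitr ltrD // hN.
Qed.

(** The graph of a linear isometry between two closed subspaces of [E]. As a relation it can be
    taken as the closure of the pairs [(X h, Y h)], with no choice of preimages under [X]. *)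
Definition isometric_relation E (G : hprod E E -> Prop) :=
  closed_subspace G /\ forall p, G p -> nsq p.1 = nsq p.2.

(** A point of the closure has both components within [e / 2] of some [X h] and [Y h] of equal norm,
    so its two norms differ by at most [e]. *)
Lemma isometric_closure H E (X Y : H -> E) : hlin X -> hlin Y ->
  (forall h, nsq (X h) = nsq (Y h)) ->
  isometric_relation (range_closure (fun h => (X h, Y h) : hprod E E)).
Proof.
move=> linX linY eXY; split.
  by apply: range_closure_closed => a x y; rewrite linX linY.
move=> p hp; rewrite -!hnorm_sqr; congr (_ ^+ 2).
have le1 (x : hprod E E) : hnorm x.1 <= hnorm x.
  by rewrite ler_hnorm nsq_prod lerDl nsq_ge0.
have le2 (x : hprod E E) : hnorm x.2 <= hnorm x.
  by rewrite ler_hnorm nsq_prod lerDr nsq_ge0.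
have XY h : hnorm (X h) = hnorm (Y h) by rewrite !hnormE eXY.
apply/eqP; rewrite eq_le; apply/andP; split; apply/ler_addgt0Pl => e e0;
  have e2 : 0 < e / 2 by lra.
- have [h hh] := hp _ e2; have h1 := le1 _; have h2 := le2 _.
  have := hnorm_dist p.1 (X h) 0; have := hnorm_dist (Y h) p.2 0.
  rewrite !subr0 XY (hnorm_distC p.1).
  by have /= := h1 ((X h, Y h) - p); have /= := h2 ((X h, Y h) - p); lra.
- have [h hh] := hp _ e2; have h1 := le1 _; have h2 := le2 _.
  have := hnorm_dist p.2 (Y h) 0; have := hnorm_dist (X h) p.1 0.
  rewrite !subr0 XY (hnorm_distC p.2).
  by have /= := h1 ((X h, Y h) - p); have /= := h2 ((X h, Y h) - p); lra.
Qed.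

(* [u] is a partial isometry and [w] its adjoint. *)
Record partial_isometry_pair E (u w : E -> E) : Prop := PartialIsometryPair {
  pi_lin : hlin u;
  pi_lin' : hlin w;
  pi_uwu : forall a, u (w (u a)) = u a;
  pi_wuw : forall b, w (u (w b)) = w b;
  pi_nsq : forall a, nsq (w (u a)) = nsq (u a);
  pi_nsq' : forall b, nsq (u (w b)) = nsq (w b);
  pi_orth : forall a b, rip (w b) (a - w (u a)) = 0;
  pi_orth' : forall a b, rip (u a) (b - u (w b)) = 0 }.

Lemma partial_isometry_pair_sym E (u w : E -> E) :
  partial_isometry_pair u w -> partial_isometry_pair w u.
Proof. by case. Qed.

(** For each [a], take the point of [G] whose first component is the orthogonal projection of [a] on
    the domain; [u a] is its second component. The map [w] arises by exchanging the components. *)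
Lemma isometric_relation_pair E (G : hprod E E -> Prop) :
  isometric_relation G ->
  exists u w, partial_isometry_pair u w /\ forall p, G p -> u p.1 = p.2 /\ w p.2 = p.1.
Proof.
move=> [cG isoG].
have ripG p s : G p -> G s -> rip p.1 s.1 = rip p.2 s.2.
  move=> Gp Gs; have := isoG _ (csubD cG Gp Gs).
  have := isoG _ Gp; have := isoG _ Gs; rewrite /nsq /= !ripE.
  rewrite (ripC s.1) (ripC s.2); lra.
have GB p s : G p -> G s -> G (p - s).
  by move=> Gp Gs; rewrite addrC -scaleN1r; apply: csub_lin.
have /choice[U UP] a : exists c, G c /\ forall s, G s -> rip (a - c.1) s.1 = 0.
  (* On [G] the two components contribute equally to the product, whence the factor 2; the lower
     bound completes the square in [s.1 - a]. *)
  have [||c Gc hc] := riesz_on_subspace (phi := fun s : hprod E E => 2 * rip a s.1)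
    (c := - 2 * nsq a) cG.
  - by move=> t x y /=; rewrite !ripE; ring.
  - move=> s Gs; rewrite nsq_prod -(isoG _ Gs).
    have := nsq_ge0 (s.1 - a); rewrite /nsq !ripE (ripC a); lra.
  exists c; split=> // s Gs; have := hc s Gs.
  rewrite rip_prod -(ripG _ _ Gc Gs) !ripE; lra.
have /choice[W WP] b : exists c, G c /\ forall s, G s -> rip (b - c.2) s.2 = 0.
  have [||c Gc hc] := riesz_on_subspace (phi := fun s : hprod E E => 2 * rip b s.2)
    (c := - 2 * nsq b) cG.
  - by move=> t x y /=; rewrite !ripE; ring.
  - move=> s Gs; rewrite nsq_prod (isoG _ Gs).
    have := nsq_ge0 (s.2 - b); rewrite /nsq !ripE (ripC b); lra.
  exists c; split=> // s Gs; have := hc s Gs.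
  rewrite rip_prod (ripG _ _ Gc Gs) !ripE; lra.
have G0 c : G c -> nsq c.1 = 0 -> c = 0.
  move=> Gc c0; apply: nsq_eq0; rewrite nsq_prod -(isoG _ Gc) c0; lra.
(* Two such points differ by an element of [G] whose first component is orthogonal to itself, and
   isometry kills the second component as well. *)
have Uu a c : G c -> (forall s, G s -> rip (a - c.1) s.1 = 0) -> U a = c.
  move=> Gc hc; have [Ga ha] := UP a; apply/eqP; rewrite -subr_eq0.
  have Gd := GB _ _ Ga Gc; apply/eqP/G0 => //.
  have := hc _ Gd; have := ha _ Gd; rewrite /nsq /= !ripE; lra.
have Wu b c : G c -> (forall s, G s -> rip (b - c.2) s.2 = 0) -> W b = c.
  move=> Gc hc; have [Gb hb] := WP b; apply/eqP; rewrite -subr_eq0.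
  have Gd := GB _ _ Gb Gc; apply/eqP/G0 => //; rewrite (isoG _ Gd).
  have := hc _ Gd; have := hb _ Gd; rewrite /nsq /= !ripE; lra.
have UG c : G c -> U c.1 = c.
  by move=> Gc; apply: Uu => // s _; rewrite subrr rip0l.
have WG c : G c -> W c.2 = c.
  by move=> Gc; apply: Wu => // s _; rewrite subrr rip0l.
have GU a : G (U a) by case: (UP a).
have GW b : G (W b) by case: (WP b).
(* Real orthogonality to both [z] and [i z] is complex orthogonality to [z], which a complex scalar
   preserves. *)
have rip_lin0 (a : R[i]) (x y z : E) : rip x z = 0 -> rip x ('i%C *: z) = 0 ->
    rip y z = 0 -> rip (a *: x + y) z = 0.
  by move=> h1 h2 h3; rewrite ripDl ripZil rip_iE h1 h2 h3; ring.
have linU a x y : U (a *: x + y) = a *: U x + U y.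
  apply: Uu => [|s Gs /=]; first exact: csub_lin.
  rewrite opprD addrACA -scalerBr.
  apply: rip_lin0; [exact: (UP x).2| |exact: (UP y).2].
  exact: ((UP x).2 _ (csubZ _ cG Gs)).
have linW a x y : W (a *: x + y) = a *: W x + W y.
  apply: Wu => [|s Gs /=]; first exact: csub_lin.
  rewrite opprD addrACA -scalerBr.
  apply: rip_lin0; [exact: (WP x).2| |exact: (WP y).2].
  exact: ((WP x).2 _ (csubZ _ cG Gs)).
exists (fun a => (U a).2), (fun b => (W b).1); split; last first.
  by move=> p Gp; rewrite UG // WG.
split.
- by move=> a x y; rewrite linU.
- by move=> a x y; rewrite linW.
- by move=> a; rewrite WG // UG.
- by move=> b; rewrite UG // WG.
- by move=> a; rewrite WG // isoG.
- by move=> b; rewrite UG // isoG.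
- by move=> a b; rewrite WG // ripC (UP a).2.
- by move=> a b; rewrite UG // ripC (WP b).2.
Qed.

(* Halmos dilation of the partial isometry [u]; its inverse is the dilation of
   the adjoint [w]. *)
Definition halmos E (u w : E -> E) (x : hprod E E) : hprod E E :=
  (u x.1 + (x.2 - u (w x.2)), w x.2 + (x.1 - w (u x.1))).

Lemma halmos_lin E (u w : E -> E) : hlin u -> hlin w -> hlin (halmos u w).
Proof.
move=> lu lw a x y; rewrite /halmos /= !(lu, lw) !opprD.
congr (_, _).
  by rewrite [a *: x.2 + _ + _]addrACA -!scalerBr addrACA -scalerDr.
by rewrite [a *: x.1 + _ + _]addrACA -!scalerBr addrACA -scalerDr.
Qed.

Lemma halmos_nsq E (u w : E -> E) x : partial_isometry_pair u w ->
  nsq (halmos u w x) = nsq x.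
Proof.
case: x => a b piP.
have nD (p r : E) : rip p r = 0 -> nsq (p + r) = nsq p + nsq r.
  by move=> h; rewrite /nsq !ripE (ripC r) h; lra.
rewrite /halmos !nsq_prod /= (nD (u a)) ?(nD (w b)) ?(pi_orth piP) ?(pi_orth' piP) //.
have ea : nsq a = nsq (w (u a)) + nsq (a - w (u a)).
  by rewrite -nD ?(pi_orth piP) // addrC subrK.
have eb : nsq b = nsq (u (w b)) + nsq (b - u (w b)).
  by rewrite -nD ?(pi_orth' piP) // addrC subrK.
by rewrite ea eb (pi_nsq piP) (pi_nsq' piP); ring.
Qed.

(** Since [u] kills [a - w (u a)] and [w] kills [b - u (w b)], the second map sees each summand
    separately and puts it back. *)
Lemma halmosK E (u w : E -> E) : partial_isometry_pair u w ->
  cancel (halmos u w) (halmos w u).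
Proof.
move=> piP [a b]; have [lu lw uwu wuw _ _ _ _] := piP; rewrite /halmos /=.
have u1 : u (w b + (a - w (u a))) = u (w b).
  by rewrite hlinD // hlinB // uwu subrr addr0.
have w1 : w (u a + (b - u (w b))) = w (u a).
  by rewrite hlinD // hlinB // wuw subrr addr0.
rewrite u1 w1 wuw uwu; congr (_, _).
  by rewrite [w b + _]addrC addrK addrC subrK.
by rewrite [u a + _]addrC addrK addrC subrK.
Qed.

(** The isometry [X h -> Y h] need not extend to a unitary of [E], since the two orthogonal
    complements may have different dimensions. The second copy of [E] gives the Halmos dilation the
    missing room. *)
Lemma unitary_extension H E (X Y : H -> E) : hlin X -> hlin Y ->
  (forall h, nsq (X h) = nsq (Y h)) ->
  exists v v' : hprod E E -> hprod E E, [/\ hlin v, hlin v',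
    forall x, nsq (v x) = nsq x, forall x, nsq (v' x) = nsq x &
    [/\ cancel v v', cancel v' v & forall h, v (X h, 0) = (Y h, 0)]].
Proof.
move=> linX linY eXY.
have [u [w [piP GP]]] := isometric_relation_pair (isometric_closure linX linY eXY).
have piP' := partial_isometry_pair_sym piP.
exists (halmos u w), (halmos w u); split.
- by apply: halmos_lin; case: piP.
- by apply: halmos_lin; case: piP.
- by move=> x; exact: halmos_nsq.
- by move=> x; exact: halmos_nsq.
split; [exact: halmosK|exact: halmosK|move=> h].
have [uX wY] := GP _ (range_closureP (fun h => (X h, Y h) : hprod E E) h).
rewrite /halmos /= in uX wY *; rewrite uX wY (hlin0 (pi_lin' piP)).
by rewrite (hlin0 (pi_lin piP)) !subr0 !addr0 subrr addr0.
Qed.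

End PartialIsometry.


Lemma l2_linE (R : realType) (H : hilbert R) a (f g : hl2 H) n :
  l2val (a *: f + g) n = a *: l2val f n + l2val g n.
Proof. by []. Qed.

(** * Shift by one block on sequences of pairs of blocks *)

Section Shift.
Variables (R : realType) (H : hilbert R).

Local Notation E := (hprod H H).
Local Notation F := (hprod E E).

(** A pair of blocks is stored transposed, first components together and second components together.
    Thus the blocks [(a, 0)] and [(b, 0)] glue to [((a, b), 0)], the form of vector on which
    [unitary_extension] prescribes [v]. *)
Definition even_block (x : F) : E := (x.1.1, x.2.1).
Definition odd_block (x : F) : E := (x.1.2, x.2.2).
Definition glue (p c : E) : F := ((p.1, c.1), (p.2, c.2)).

Lemma nsq_glue p c : nsq (glue p c) = nsq p + nsq c.
Proof. by rewrite !nsq_prod /= addrACA. Qed.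

Lemma glueK x : glue (even_block x) (odd_block x) = x.
Proof. by case: x => [[a b] [c d]]. Qed.

Lemma nsq_blocks x : nsq x = nsq (even_block x) + nsq (odd_block x).
Proof. by rewrite -nsq_glue glueK. Qed.

Lemma even_block_lin : hlin even_block. Proof. by []. Qed.

Lemma odd_block_lin : hlin odd_block. Proof. by []. Qed.

Lemma glue_lin a p p' c c' :
  glue (a *: p + p') (a *: c + c') = a *: glue p c + glue p' c'.
Proof. by []. Qed.

(** Moving by one block crosses pair boundaries: each new pair joins the odd half of the preceding
    pair to the even half of the current one. *)
Definition shift_seq (g : E) (f : nat -> F) (n : nat) : F :=
  glue (if n is m.+1 then odd_block (f m) else g) (even_block (f n)).

Lemma shift_seq_sum g f N : \sum_(n < N.+1) nsq (shift_seq g f n) =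
  nsq g + \sum_(n < N) nsq (f n) + nsq (even_block (f N)).
Proof.
elim: N => [|N IH].
  by rewrite big_ord_recr !big_ord0 /= nsq_glue add0r addr0.
rewrite big_ord_recr /= IH nsq_glue [in RHS]big_ord_recr /= (nsq_blocks (f N)).
by ring.
Qed.

Lemma shift_seq_sum_le g f N : \sum_(n < N) nsq (shift_seq g f n) <=
  nsq g + \sum_(n < N) nsq (f n).
Proof.
case: N => [|N]; first by rewrite !big_ord0 addr0 nsq_ge0.
rewrite shift_seq_sum big_ord_recr /= (nsq_blocks (f N)).
have := nsq_ge0 (odd_block (f N)); lra.
Qed.

Lemma shift_bounded g (f : hl2 F) : shift_seq g (l2val f) \in @l2pred R F.
Proof.
apply/asboolP; exists (nsq g + nsq f) => N.
by apply: le_trans (shift_seq_sum_le _ _ _) _; rewrite lerD2l; exact: psum_le_l2form.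
Qed.

Definition shift (g : E) (f : hl2 F) : hl2 F := L2 (shift_bounded g f).

Lemma shiftE g f n : l2val (shift g f) n = shift_seq g (l2val f) n.
Proof. by []. Qed.

(** The first [N] shifted pairs contain at most [g] and [N] old pairs, while the first [N + 1]
    contain at least these; both bounds pass to the limit. *)
Lemma shift_nsq g f : nsq (shift g f) = nsq g + nsq f.
Proof.
apply/eqP; rewrite eq_le; apply/andP; split.
  apply: l2form_le => N; apply: le_trans (shift_seq_sum_le _ _ _) _.
  by rewrite lerD2l; exact: psum_le_l2form.
rewrite -lerBrDl; apply: l2form_le => N; rewrite lerBrDl.
apply: le_trans (psum_le_l2form (shift g f) N.+1).
rewrite [X in _ <= X](shift_seq_sum g (l2val f) N).
by rewrite lerDl nsq_ge0.
Qed.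

Lemma shift_lin a g g' f f' :
  shift (a *: g + g') (a *: f + f') = a *: shift g f + shift g' f'.
Proof.
apply: l2_eq => n; rewrite l2_linE !shiftE /shift_seq l2_linE even_block_lin -glue_lin.
by case: n => [|n]; [reflexivity | rewrite l2_linE odd_block_lin; reflexivity].
Qed.

Lemma shift_shift g g' f n :
  l2val (shift g (shift g' f)) n = if n is m.+1 then l2val f m else glue g g'.
Proof.
case: n => [|n]; rewrite /= /shift_seq; first by case: g g' => [? ?] [? ?].
by rewrite -[RHS]glueK.
Qed.

End Shift.

(** * Diagonal isometries of the sequence space *)

Section Diagonal.
Local Open Scope classical_set_scope.
Variables (R : realType) (H : hilbert R) (A : nat -> H -> H).
Hypotheses (linA : forall n, hlin (A n)) (nsqA : forall n x, nsq (A n x) = nsq x).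

Lemma diag_bounded (f : hl2 H) : (fun n => A n (l2val f n)) \in @l2pred R H.
Proof.
apply/asboolP; exists (nsq f) => N; under eq_bigr do rewrite nsqA.
exact: psum_le_l2form.
Qed.

Definition diag_op (f : hl2 H) : hl2 H := L2 (diag_bounded f).

Lemma diag_lin : hlin diag_op.
Proof. by move=> a f g; apply: l2_eq => n; exact: linA. Qed.

Lemma diag_nsq f : nsq (diag_op f) = nsq f.
Proof.
rewrite !nsq_hl2 /l2form; congr (limn _); apply/funext => N.
by apply: eq_bigr => n _; exact: nsqA.
Qed.

End Diagonal.

Lemma nsq_unimodular (R : realType) (H : hilbert R) (q : R[i]) (x : H) :
  `|q| = 1 -> nsq (q *: x) = nsq x.
Proof.
rewrite nsqZi; case: q => a b [] /= h.
rewrite -[RHS]mul1r; congr (_ * _).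
by rewrite -[LHS]sqr_sqrtr ?addr_ge0 ?sqr_ge0 // h expr1n.
Qed.

Lemma hlin_isometry (R : realType) (H : hilbert R) (V : H -> H) :
  hlin V -> (forall x, nsq (V x) = nsq x) -> hisometry V.
Proof.
move=> lV nV; have nV' x : hnorm (V x) = hnorm x by rewrite !hnormE nV.
by split=> //; split=> //; exists 1 => x; rewrite nV' mul1r.
Qed.

Lemma hip_prod (R : realType) (H K : hilbert R) (x y : hprod H K) :
  hip x y = hip x.1 y.1 + hip x.2 y.2.
Proof. by rewrite !hipE. Qed.

Lemma hip0r (R : realType) (H : hilbert R) (x : H) : hip x 0 = 0.
Proof. by rewrite hipE scaler0 rip0r. Qed.

(** * Liftings along the first summand of an orthogonal sum *)

Section Lifting.
Variables (R : realType) (H L : hilbert R).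

Definition inl_prod (h : H) : hprod H L := (h, 0).

Lemma hip_inl (z : hprod H L) (h : H) : hip z (inl_prod h) = hip z.1 h.
Proof. by rewrite hip_prod hip0r addr0. Qed.

Lemma inl_embedding : hembedding inl_prod.
Proof.
have ip x y : hip (inl_prod x) (inl_prod y) = hip x y by rewrite hip_inl.
split=> //; split.
  by move=> a x y; rewrite /inl_prod; congr (_, _); rewrite /= scaler0 addr0.
by exists 1 => x; rewrite mul1r /hnorm /ip_norm ip.
Qed.

Lemma horth_inl (z : hprod H L) : horth inl_prod z <-> z.1 = 0.
Proof.
split=> [h|h x]; last by rewrite hip_inl h hipE !rip0l.
by apply: hip_eq0; rewrite -hip_inl h.
Qed.

Lemma compresses_inl (S : hprod H L -> hprod H L) (T : H -> H) :
  (forall z, (S z).1 = T z.1) -> hcompresses_to inl_prod S T.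
Proof. by move=> h x y; rewrite hip_inl h. Qed.

Lemma lifting_inl (S : hprod H L -> hprod H L) (T : H -> H) : hlin T ->
  (forall z, (S z).1 = T z.1) -> hlifting inl_prod S T.
Proof.
move=> lT h; split; last exact: compresses_inl.
by move=> z /horth_inl z0; apply/horth_inl; rewrite h z0 hlin0.
Qed.

Lemma iter_fst (S : hprod H L -> hprod H L) (T : H -> H) n z :
  (forall z, (S z).1 = T z.1) -> (iter n S z).1 = iter n T z.1.
Proof. by move=> h; elim: n => //= n IH; rewrite h IH. Qed.

(** The relation [(S z).1 = T z.1] holds on the whole sum, so it composes, and words in such
    operators compress to the same words in [T] and [T']. *)
Lemma compresses_iter (S S' : hprod H L -> hprod H L) (T T' : H -> H) n m :
  (forall z, (S z).1 = T z.1) -> (forall z, (S' z).1 = T' z.1) ->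
  hcompresses_to inl_prod (iter n S \o iter m S') (iter n T \o iter m T').
Proof.
move=> h h'; apply: compresses_inl => z /=.
by rewrite (iter_fst _ _ h) (iter_fst _ _ h').
Qed.

End Lifting.

(** * Assembling the twisted lifting *)

Theorem mainTheorem2 (R : realType) (H : hilbert R) (T1 T2 Q : H -> H) :
  hcontraction T1 -> hcontraction T2 -> hunitary Q ->
  (forall x : H, T2 (T1 x) = Q (T1 (T2 x))) ->
  forall q : R[i], `|q| = 1 ->
  exists (K : hilbert R) (J : H -> K) (V1 V2 Qb : K -> K),
    hembedding J /\
    hisometry V1 /\ hisometry V2 /\
    hunitary Qb /\
    hreduces J Qb /\
    (forall x : H, Qb (J x) = J (Q x)) /\
    (forall z : K, horth J z -> Qb z = q *: z) /\
    (forall z : K, V2 (V1 z) = Qb (V1 (V2 z))) /\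
    hlifting J V1 T1 /\ hlifting J V2 T2 /\
    (forall n m : nat, hcompresses_to J (iter n V1 \o iter m V2) (iter n T1 \o iter m T2)) /\
    (forall n m : nat, hcompresses_to J (iter n V2 \o iter m V1) (iter n T2 \o iter m T1)).
Proof.
move=> [[linT1 _] T1_le] [[linT2 _] T2_le] [[[linQ _] Q_iso] Q_surj] T21 q q1.
have q0 : q != 0 by rewrite -normr_eq0 q1 oner_eq0.
have qn n : `|q ^+ n| = 1 by rewrite normrX q1 expr1n.
have qVn n : `|(q ^+ n)^-1| = 1 by rewrite normfV qn invr1.
have [D1 linD1 nsqD1] := defect_operator linT1 T1_le.
have [D2 linD2 nsqD2] := defect_operator linT2 T2_le.
pose E := hprod H H; pose F := hprod E E.
pose X h : E := (D1 (T2 h), D2 h); pose Y h : E := q^-1 *: ((D2 (T1 h), D1 h) : E).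
have linX : hlin X by move=> a x y; rewrite /X linT2 linD1 linD2.
have linY : hlin Y.
  move=> a x y; rewrite /Y linT1 linD1 linD2 scalerA [a * _]mulrC -scalerA.
  by rewrite -scalerDr.
have nsqXY h : nsq (X h) = nsq (Y h).
  rewrite nsq_unimodular; last by have := qVn 1%N; rewrite expr1.
  (* Both sums telescope to [nsq h - nsq (T1 (T2 h))], the right one because [Q] is isometric. *)
  rewrite !nsq_prod /= !nsqD1 !nsqD2 T21.
  have : nsq (Q (T1 (T2 h))) = nsq (T1 (T2 h)) by rewrite -!hnorm_sqr Q_iso.
  by move=> ->; ring.
have [v [v' [linv linv' nsqv nsqv' [vK v'K vX]]]] := unitary_extension linX linY nsqXY.
pose A n (x : F) : F := (q ^+ n)^-1 *: v x.
pose A' n (x : F) : F := q ^+ n *: v' x.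
have linA n : hlin (A n).
  by move=> a x y; rewrite /A linv scalerDr !scalerA mulrC.
have linA' n : hlin (A' n).
  by move=> a x y; rewrite /A' linv' scalerDr !scalerA mulrC.
have nsqA n x : nsq (A n x) = nsq x by rewrite nsq_unimodular // nsqv.
have nsqA' n x : nsq (A' n x) = nsq x by rewrite nsq_unimodular // nsqv'.
pose V := diag_op nsqA; pose V' := diag_op nsqA'.
have VK : cancel V V'.
  move=> f; apply: l2_eq => n.
  change (A' n (A n (l2val f n)) = l2val f n).
  by rewrite /A /A' (hlinZ _ _ linv') scalerA divff ?expf_neq0 // scale1r vK.
have linV : hlin V by exact: diag_lin.
have linV' : hlin V' by exact: diag_lin.
pose K := hprod H (hl2 F).
pose V1 (z : K) : K := (T1 z.1, V (shift (D1 z.1, 0) z.2)).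
pose V2 (z : K) : K := (T2 z.1, shift (D2 z.1, 0) (V' z.2)).
pose Qb (z : K) : K := (Q z.1, q *: z.2).
have blocklin (D : H -> H) a x y : hlin D ->
    (D (a *: x + y), 0) = a *: ((D x, 0) : E) + (D y, 0).
  by move=> lD; rewrite lD; congr (_, _); rewrite /= scaler0 addr0.
have linV1 : hlin V1.
  by move=> a x y; rewrite /V1 linT1 blocklin // shift_lin linV.
have linV2 : hlin V2.
  by move=> a x y; rewrite /V2 linT2 blocklin // linV' shift_lin.
have linQb : hlin Qb.
  by move=> a x y; rewrite /Qb linQ; congr (_, _); rewrite /= scalerDr !scalerA mulrC.
have nsqblock (x : H) : nsq ((x, 0) : E) = nsq x.
  by rewrite nsq_prod /= /nsq rip0l addr0.
have nsqV1 z : nsq (V1 z) = nsq z.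
  rewrite !nsq_prod /= diag_nsq shift_nsq nsqblock nsqD1; ring.
have nsqV2 z : nsq (V2 z) = nsq z.
  rewrite !nsq_prod /= shift_nsq diag_nsq nsqblock nsqD2; ring.
have nsqQb z : nsq (Qb z) = nsq z.
  by rewrite !nsq_prod /= nsq_unimodular // -!hnorm_sqr Q_iso.
exists K, (@inl_prod R H (hl2 F)), V1, V2, Qb.
split; first exact: inl_embedding.
split; first exact: hlin_isometry.
split; first exact: hlin_isometry.
have QbJ x : Qb (inl_prod _ x) = inl_prod _ (Q x).
  by rewrite /Qb /inl_prod /= scaler0.
split.
  split; first exact: hlin_isometry.
  move=> [y f]; have [x <-] := Q_surj y; exists (x, q^-1 *: f).
  by rewrite /Qb /= scalerA divff // scale1r.
split.
  split=> [x|z /horth_inl z0]; first by exists (Q x).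
  by apply/horth_inl; rewrite /= z0 hlin0.
split=> //.
split.
  move=> [h f] /horth_inl /= ->; rewrite /Qb /= hlin0 //.
  by congr (_, _); rewrite scaler0.
split.
  move=> [h f]; rewrite /V1 /V2 /Qb /= VK T21; congr (_, _).
  apply: l2_eq => n.
  (* On the left, [V'] and [V] meet between the two shifts and have cancelled; on the right they
     stay outside the double shift. *)
  change (l2val (shift (D2 (T1 h), 0) (shift (D1 h, 0) f)) n =
    q *: A n (l2val (shift (D1 (T2 h), 0) (shift (D2 h, 0) (V' f))) n)).
  rewrite !shift_shift; case: n => [|n].
    (* Pair 0 holds only new defect vectors: [v] sends [X h] to [Y h], and the outer [q] cancels the
       [q^-1] in [Y]. *)
    rewrite /A expr0 invr1 scale1r.
    rewrite -[glue (D1 (T2 h), 0) _]/((X h, 0) : F) vX.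
    change (glue (D2 (T1 h), 0) (D1 h, 0) = (q *: Y h, q *: 0) :> F).
    by rewrite /Y scalerA divff // scale1r scaler0.
  (* The old pair [n] now sits at [n + 1], so the scalars multiply to [q * q^-(n+1) * q^n = 1]. *)
  rewrite -[l2val (V' f) n]/(A' n (l2val f n)) /A /A' (hlinZ _ _ linv) v'K !scalerA.
  by rewrite exprS invfM mulrA divff // mul1r mulVf ?expf_neq0 // scale1r.
split; first exact: lifting_inl.
split; first exact: lifting_inl.
by split=> n m; apply: compresses_iter.
Qed.
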